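(* Assume that $D_0, D_1, D_2, \dots$ are mutually different. On the solutions to $c_{m+1}(B)=0$ expressed as $$B = -D_k - D_k^{[1],(m+1)} s - D_k^{[2],(m+1)} s^2 + O(s^3),$$ we have the following. For $k=2,\dots,m-2$, $$\begin{aligned} D_k^{[2],(m+1)} = {}& -\Bigl\{ \frac{k(k-1+\gamma)F_k}{(D_k-D_{k-1})^2} + \frac{(k+1)(k+\gamma)F_{k+1}}{(D_k-D_{k+1})^2} \Bigr\} \\ & \quad\cdot \Bigl\{ E_k + \frac{k(k-1+\gamma)F_k}{D_k-D_{k-1}} + \frac{(k+1)(k+\gamma)F_{k+1}}{D_k-D_{k+1}} \Bigr\} \\ & + \frac{k(k-1+\gamma)F_k}{(D_k-D_{k-1})^2} \Bigl\{ E_{k-1} + \frac{(k-1)(k-2+\gamma)F_{k-1}}{D_k-D_{k-2}} \Bigr\} \\ & + \frac{(k+1)(k+\gamma)F_{k+1}}{(D_k-D_{k+1})^2} \Bigl\{ E_{k+1} + \frac{(k+2)(k+1+\gamma)F_{k+2}}{D_k-D_{k+2}} \Bigr\} . \end{aligned}$$ For $k=1$ (with $m\ge 3$), $$\begin{aligned} D_1^{[2],(m+1)} = {}& -\Bigl\{ \frac{\gamma F_1}{(D_1-D_0)^2} + \frac{2(1+\gamma)F_2}{(D_1-D_2)^2} \Bigr\} \Bigl\{ E_1 + \frac{\gamma F_1}{D_1-D_0} + \frac{2(1+\gamma)F_2}{D_1-D_2} \Bigr\} \\ & + \frac{\gamma E_0F_1}{(D_1-D_0)^2} + \frac{2(1+\gamma)F_2}{(D_1-D_2)^2}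 \Bigl\{ E_2 + \frac{3(2+\gamma)F_3}{D_1-D_3} \Bigr\} . \end{aligned}$$ For $k=0$ (with $m\ge 2$), $$D_0^{[2],(m+1)} = \frac{\gamma F_1}{(D_0-D_1)^2} \Bigl[ E_1 - E_0 - \frac{\gamma F_1}{D_0-D_1} + \frac{2(1+\gamma)F_2}{D_0-D_2} \Bigr] .$$
   Context: Let $\gamma \in \mathbb{C}$ with $\gamma \notin \{0,-1,-2,\dots\}$, and let $(D_m)_{m\ge 0}$, $(E_m)_{m\ge 0}$, $(F_m)_{m\ge 0}$ be sequences of complex numbers, independent of the variables $B$ and $s$. Define polynomials $c_m(B)$ in the variables $B$ and $s$ by $c_{-1}(B)=0$, $c_0(B)=1$ and $$c_{m+1}(B) = \frac{(B+D_m+sE_m)\,c_m(B) - sF_m\,c_{m-1}(B)}{(m+1)(m+\gamma)}, \quad m=0,1,2,\dots .$$ (The cases of interest have $D_m=m(m-1+\gamma+\delta)$ with: $E_m=m(m-1+\gamma+\epsilon)$, $F_m=(m-1+\alpha)(m-1+\beta)$, where $\gamma+\delta+\epsilon=\alpha+\beta+1$, for the Heun equation; $E_m=m$, $F_m=m-1+\alpha$ for the singly confluent Heun equation; $E_m=0$, $F_m=1$ for the reduced singly confluent Heun equation. For this $D_m$, mutual distinctness of $D_0,D_1,\dots$ is equivalent to $\gamma+\delta\notin\mathbb{Z}_{\le 0}$.) When $D_0,D_1,D_2,\dots$ are mutually different and $0\le k\le m$, the analytic implicit function theorem gives a unique germ of analytic function $D_{k,m+1}(s)$ at $s=0$ with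 $D_{k,m+1}(0)=D_k$ and $c_{m+1}(-D_{k,m+1}(s))=0$ for all $s$ near $0$. Its Taylor coefficients are denoted by $D_k^{[j],(m+1)}$: $$D_{k,m+1}(s) = D_k + \sum_{j=1}^{\infty} D_k^{[j],(m+1)} s^j .$$ The solution of $c_{m+1}(B)=0$ labelled by $k$ is $B=-D_{k,m+1}(s)$; $O(s^n)$ refers to $s\to 0$. *)

(* Defs.v *)
From Stdlib Require Import Reals.
From Coquelicot Require Import Coquelicot.

Open Scope C_scope.

(* The pair (c_{m-1}(B), c_m(B)), starting from (c_{-1}, c_0) = (0, 1), as
   (polynomial) functions of B and s.  The sequences D, E, F are indexed
   by m >= 0 and do not depend on B or s. *)
Fixpoint c_pair (gamma : C) (D E F : nat -> C) (B s : C) (m : nat) : C * C :=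
  match m with
  | O => (RtoC 0, RtoC 1)
  | S n =>
      let p := c_pair gamma D E F B s n in
      (snd p,
       ((B + D n + s * E n) * snd p - s * F n * fst p)
         / ((RtoC (INR n) + RtoC 1) * (RtoC (INR n) + gamma)))
  end.

Definition c (gamma : C) (D E F : nat -> C) (m : nat) (B s : C) : C :=
  snd (c_pair gamma D E F B s m).

(* f represents the germ D_{k,m+1} at s = 0, and a j is its j-th Taylor
   coefficient D_k^{[j],(m+1)}.  Analyticity is complex: f is the sum of the
   power series a on a full neighbourhood of 0 in the complex plane. *)
Definition root_germ (gamma : C) (D E F : nat -> C) (k m : nat)
    (f : C -> C) (a : nat -> C) : Prop :=
  f (RtoC 0) = D k /\
  locally (RtoC 0) (fun s : C => is_pseries a s (f s)) /\
  locally (RtoC 0) (fun s : C => c gamma D E F (S m) (- f s) s = RtoC 0).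

(* Main.v *)
Require Import Defs.
From Stdlib Require Import Reals Lra Lia.
From Coquelicot Require Import Coquelicot.

Open Scope C_scope.

(** The recurrence says that the root f(s) is an eigenvalue of a tridiagonal
    matrix with diagonal entries [D j + s E j] in which the levels [j - 1] and
    [j] are coupled by [s * G j], where [G j = j (j - 1 + gamma) F j].  Dividing
    the recurrence at level [j] by [c j] expresses the ratio of consecutive
    terms as a finite continued fraction, in two ways: climbing from
    [c_{-1} = 0] ([lower_ratio]) and descending from [c_{m+1} = 0]
    ([upper_ratio]).  All denominators at the levels [j <> k] tend to
    [D k - D j <> 0] as [s] tends to 0, so the division is legitimate near 0.
    Matching the two expansions at level [k] turns the characteristic equation
    into ([root_equation])

      (f(s) - D k) / s = E k + lower(s) + upper(s).

    Letting [s] tend to 0 gives the first Taylor coefficient [a 1].  The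
    difference quotient of the same equation gives the second one, because the
    slope at 0 of one step [g / (f - d - s e - s t)] of a continued fraction only
    involves [a 1] and the limit of the tail [t] ([tends_step_slope]); hence only
    the levels at distance at most 2 from [k] appear.  That the coefficients of the power
    series are the limits of the iterated difference quotients of its sum is
    [tends_taylor].

    The cases [k = 0] and [k = 1] obey the general formula: the levels missing
    below carry the coupling [G 0 = 0]. *)

(** * Limits at the punctured origin *)

Definition near0 : (C -> Prop) -> Prop := locally' (RtoC 0).

(** The target carries the uniform structure given by the modulus, in which
    multiplication is known to be continuous; its neighbourhoods are those of the
    product structure on the plane by [locally_C]. *)
Definition tends (g : C -> C) (l : C) : Prop :=
  filterlim g near0 (@locally (AbsRing_UniformSpace C_AbsRing) l).

Global Instance near0_filter : ProperFilter near0.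
Proof.
split.
- intros P [e He].
  assert (Hh : (0 < e / 2)%R) by (destruct e; simpl; lra).
  exists (RtoC (e / 2)). apply He.
  + apply C_NormedModule_mixin_compat1. unfold minus, plus, opp; simpl.
    replace (RtoC (e / 2) + - RtoC 0) with (RtoC (e / 2)) by ring.
    rewrite Cmod_R, Rabs_pos_eq; destruct e; simpl in *; lra.
  + intros H; apply RtoC_inj in H; lra.
- apply within_filter, locally_filter.
Qed.

Lemma near0_neq0 : near0 (fun s => s <> RtoC 0).
Proof. exists (mkposreal 1 Rlt_0_1); auto. Qed.

Lemma near0_Cmod (e : R) : (0 < e)%R -> near0 (fun s => (Cmod s < e)%R).
Proof.
intros He.
assert (H : locally (RtoC 0) (fun s : C => (Cmod s < e)%R)).
{ apply locally_C. exists (mkposreal e He). intros y Hy.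
  replace y with (minus y (RtoC 0)); [exact Hy|].
  unfold minus, plus, opp; simpl; ring. }
destruct H as [d Hd]. exists d. intros y Hy _. now apply Hd.
Qed.

Lemma near0_of_locally (P : C -> Prop) : locally (RtoC 0) P -> near0 P.
Proof. intros [d Hd]. exists d. intros y Hy _. now apply Hd. Qed.

Lemma tends_eps (g : C -> C) (l : C) :
  tends g l <-> forall e : R, (0 < e)%R -> near0 (fun s => (Cmod (g s - l) < e)%R).
Proof.
split.
- intros H e He.
  exact (proj1 (@filterlim_locally _ (AbsRing_UniformSpace C_AbsRing) near0 _ g l)
           H (mkposreal e He)).
- intros H.
  apply (proj2 (@filterlim_locally _ (AbsRing_UniformSpace C_AbsRing) near0 _ g l)).
  intros e. apply H, cond_pos.
Qed.

Lemma tends_const (l : C) : tends (fun _ => l) l.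
Proof. exact (@filterlim_const _ (AbsRing_UniformSpace C_AbsRing) near0 _ l). Qed.

Lemma tends_id : tends (fun s => s) (RtoC 0).
Proof.
apply tends_eps; intros e He. generalize (near0_Cmod e He).
apply filter_imp; intros s Hs. now replace (s - RtoC 0) with s by ring.
Qed.

Lemma tends_plus (g h : C -> C) (l k : C) :
  tends g l -> tends h k -> tends (fun s => g s + h s) (l + k).
Proof.
intros Hg Hh.
exact (filterlim_comp_2 _ _ _ Hg Hh
         (@filterlim_plus C_AbsRing (AbsRing_NormedModule C_AbsRing) l k)).
Qed.

Lemma tends_mult (g h : C -> C) (l k : C) :
  tends g l -> tends h k -> tends (fun s => g s * h s) (l * k).
Proof.
intros Hg Hh.
exact (filterlim_comp_2 _ _ _ Hg Hh (@filterlim_mult C_AbsRing l k)).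
Qed.

Lemma tends_minus (g h : C -> C) (l k : C) :
  tends g l -> tends h k -> tends (fun s => g s - h s) (l - k).
Proof.
intros Hg Hh. apply tends_plus; trivial.
exact (filterlim_comp _ _ _ _ _ _ _ _ Hh
         (@filterlim_opp C_AbsRing (AbsRing_NormedModule C_AbsRing) k)).
Qed.

Lemma tends_ext (g h : C -> C) (l : C) :
  near0 (fun s => g s = h s) -> tends g l -> tends h l.
Proof. intros H. now apply filterlim_ext_loc. Qed.

Lemma tends_unique (g : C -> C) (l k : C) : tends g l -> tends g k -> l = k.
Proof.
exact (@filterlim_locally_unique C C_AbsRing (AbsRing_NormedModule C_AbsRing)
         near0 (Proper_StrongProper _ near0_filter) g l k).
Qed.

(** A quantitative lower bound on [g], which both keeps denominators away from 0
    and controls the modulus of their inverses. *)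
Lemma tends_half (g : C -> C) (l : C) : tends g l -> l <> RtoC 0 ->
  near0 (fun s => (Cmod l / 2 <= Cmod (g s))%R).
Proof.
intros Hg Hl. assert (Hl' := Cmod_gt_0 l).
generalize (proj1 (tends_eps g l) Hg (Cmod l / 2)%R ltac:(apply Hl' in Hl; lra)).
apply filter_imp; intros s Hs.
generalize (Cmod_triangle (g s) (- (g s - l))).
replace (g s + - (g s - l)) with l by ring. rewrite Cmod_opp. lra.
Qed.

Lemma tends_neq0 (g : C -> C) (l : C) : tends g l -> l <> RtoC 0 ->
  near0 (fun s => g s <> RtoC 0).
Proof.
intros Hg Hl. generalize (tends_half g l Hg Hl). apply filter_imp.
intros s Hs E. rewrite E, Cmod_0 in Hs. apply Cmod_gt_0 in Hl. lra.
Qed.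

Lemma tends_div (g h : C -> C) (l k : C) :
  tends g l -> tends h k -> k <> RtoC 0 -> tends (fun s => g s / h s) (l / k).
Proof.
intros Hg Hh Hk. apply tends_mult; trivial.
apply tends_eps; intros e He.
assert (Hm : (0 < Cmod k)%R) by now apply Cmod_gt_0.
assert (He' : (0 < e * (Cmod k * (Cmod k / 2)))%R)
  by (repeat apply Rmult_lt_0_compat; lra).
generalize (filter_and _ _ (tends_half h k Hh Hk)
              (proj1 (tends_eps h k) Hh _ He')).
apply filter_imp; intros s [H1 H2].
assert (Hs : h s <> RtoC 0) by (apply Cmod_gt_0; lra).
replace (/ h s - / k) with (- (h s - k) * / (k * h s)) by (field; auto).
rewrite Cmod_mult, Cmod_opp, Cmod_inv, Cmod_mult by now apply Cmult_neq_0.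
apply Rmult_lt_reg_r with (Cmod k * Cmod (h s))%R.
{ apply Rmult_lt_0_compat; lra. }
rewrite Rmult_assoc, Rinv_l, Rmult_1_r by (apply Rmult_integral_contrapositive_currified; lra).
eapply Rlt_le_trans; [exact H2|].
apply Rmult_le_compat_l; [lra|]. apply Rmult_le_compat_l; lra.
Qed.

(** * Power series near the origin *)

Lemma is_series_norm_le (u : nat -> C) (l : C) (q : R) :
  (forall n, (Cmod (u n) <= q * (/ 2) ^ n)%R) -> is_series u l -> (Cmod l <= 2 * q)%R.
Proof.
intros Hu Hl.
assert (Hq : (0 <= q)%R).
{ generalize (Hu 0%nat) (Cmod_ge_0 (u 0%nat)); simpl; lra. }
assert (Hs : forall n, (Cmod (sum_n u n) <= q * (2 - (/ 2) ^ n))%R).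
{ induction n as [|n IH].
  - rewrite sum_O. generalize (Hu 0%nat); simpl; lra.
  - rewrite sum_Sn. eapply Rle_trans; [apply Cmod_triangle|].
    generalize (Hu (S n)); simpl. lra. }
refine (is_lim_seq_le (fun n => Cmod (sum_n u n)) (fun _ => (2 * q)%R) (Cmod l) (2 * q)%R
          _ _ (is_lim_seq_const _)).
- intros n. eapply Rle_trans; [apply Hs|].
  assert (0 < (/ 2) ^ n)%R by (apply pow_lt; lra). nra.
- exact (filterlim_comp _ _ _ _ _ _ _ _ Hl
           (@filterlim_norm C_AbsRing C_NormedModule l)).
Qed.

Lemma Cmod_pow_n (x : C) (n : nat) : Cmod (@pow_n C_Ring x n) = (Cmod x ^ n)%R.
Proof.
induction n as [|n IH]; simpl; [apply Cmod_1|].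
change (@mult C_Ring x (@pow_n C_Ring x n)) with (x * @pow_n C_Ring x n).
now rewrite Cmod_mult, IH.
Qed.

Lemma pseries_terms_bounded (b : nat -> C) (x l : C) : is_pseries b x l ->
  exists M : R, forall n, (Cmod (b n) * Cmod x ^ n <= M)%R.
Proof.
intros H.
destruct (@filterlim_bounded C_AbsRing C_NormedModule
  (sum_n (fun k => scal (pow_n x k) (b k))) (ex_intro _ l H)) as [M HM].
change (forall n, (Cmod (sum_n (fun k => scal (pow_n x k) (b k)) n) <= M)%R) in HM.
exists (2 * M)%R. intros n.
assert (E : (Cmod (b n) * Cmod x ^ n)%R = Cmod (@pow_n C_Ring x n * b n)).
{ rewrite Cmod_mult, Cmod_pow_n. ring. }
rewrite E. destruct n as [|n].
- assert (H0 := HM 0%nat). rewrite sum_O in H0.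
  change (Cmod (@pow_n C_Ring x 0 * b 0%nat) <= M)%R in H0.
  generalize (Cmod_ge_0 (@pow_n C_Ring x 0 * b 0%nat)). lra.
- assert (H0 := HM n). assert (H1 := HM (S n)). rewrite sum_Sn in H1.
  set (S0 := sum_n (fun k => @scal C_Ring C_NormedModule (pow_n x k) (b k)) n : C).
  change (Cmod S0 <= M)%R in H0.
  change (Cmod (S0 + @pow_n C_Ring x (S n) * b (S n)) <= M)%R in H1.
  generalize (Cmod_triangle (S0 + @pow_n C_Ring x (S n) * b (S n)) (- S0)).
  rewrite Cmod_opp.
  replace (S0 + @pow_n C_Ring x (S n) * b (S n) + - S0)
    with (@pow_n C_Ring x (S n) * b (S n)) by ring. lra.
Qed.

Lemma near0_pseries_quotient (b : nat -> C) (h : C -> C) :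
  near0 (fun s => is_pseries b s (h s)) ->
  near0 (fun s => is_pseries (PS_decr_1 b) s ((h s - b 0%nat) / s)).
Proof.
intros H. generalize (filter_and _ _ H near0_neq0).
apply filter_imp; intros s [Hs Hs0].
assert (Hi : @mult C_AbsRing (/ s) s = @one C_AbsRing) by (apply Cinv_l; auto).
replace ((h s - b 0%nat) / s) with (/ s * (h s - b 0%nat)) by apply Cmult_comm.
exact (@is_pseries_decr_1 C_AbsRing C_NormedModule b s (/ s) (h s) Hi Hs).
Qed.

(** Convergence at one point [x <> 0] bounds the terms there, so for
    [Cmod s < Cmod x / 2] the shifted series [(h s - b 0) / s] is dominated by a
    geometric series of ratio 1/2; hence [h s - b 0 = O(s)]. *)
Lemma tends_pseries (b : nat -> C) (h : C -> C) :
  near0 (fun s => is_pseries b s (h s)) -> tends h (b 0%nat).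
Proof.
intros H.
destruct (filter_ex _ (filter_and _ _ H near0_neq0)) as [x [Hx Hx0]].
destruct (pseries_terms_bounded b x (h x) Hx) as [M HM].
assert (Hx' : (0 < Cmod x)%R) by now apply Cmod_gt_0.
assert (HM0 : (0 <= M)%R).
{ generalize (HM 0%nat) (Cmod_ge_0 (b 0%nat)); simpl; lra. }
apply tends_eps; intros e He.
(* The bound on the quotient (h s - b 0) / s. *)
set (Q := (2 * (M / Cmod x))%R).
assert (HQ : (0 <= Q)%R).
{ unfold Q. apply Rmult_le_pos; [lra|]. apply Rdiv_le_0_compat; lra. }
assert (He' : (0 < e / (Q + 1))%R) by (apply Rdiv_lt_0_compat; lra).
assert (Hx2 : (0 < Cmod x / 2)%R) by lra.
generalize (filter_and _ _ (near0_pseries_quotient b h H)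
  (filter_and _ _ near0_neq0
    (filter_and _ _ (near0_Cmod _ Hx2) (near0_Cmod _ He')))).
apply filter_imp; intros s [Hs [Hs0 [Hs1 Hs2]]].
assert (Hb : (Cmod ((h s - b 0%nat) / s) <= Q)%R).
{ refine (is_series_norm_le _ _ _ _ Hs). intros n.
  change (Cmod (@pow_n C_Ring s n * b (S n)) <= M / Cmod x * (/ 2) ^ n)%R.
  rewrite Cmod_mult, Cmod_pow_n.
  assert (Hp : (Cmod s ^ n <= (Cmod x * / 2) ^ n)%R).
  { apply pow_incr; split; [apply Cmod_ge_0|lra]. }
  rewrite Rpow_mult_distr in Hp.
  assert (H2 : (0 < (/ 2) ^ n)%R) by (apply pow_lt; lra).
  apply Rle_trans with (Cmod x ^ n * (/ 2) ^ n * Cmod (b (S n)))%R.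
  - apply Rmult_le_compat_r; [apply Cmod_ge_0|exact Hp].
  - replace (Cmod x ^ n * (/ 2) ^ n * Cmod (b (S n)))%R
      with (Cmod (b (S n)) * Cmod x ^ S n / Cmod x * (/ 2) ^ n)%R by (simpl; field; lra).
    apply Rmult_le_compat_r; [lra|]. apply Rmult_le_compat_r; [|apply HM].
    apply Rlt_le, Rinv_0_lt_compat; lra. }
replace (h s - b 0%nat) with ((h s - b 0%nat) / s * s) by (field; auto).
rewrite Cmod_mult.
apply Rle_lt_trans with (Q * Cmod s)%R.
{ apply Rmult_le_compat_r; [apply Cmod_ge_0|exact Hb]. }
apply Rle_lt_trans with (Q * (e / (Q + 1)))%R.
{ apply Rmult_le_compat_l; lra. }
replace (Q * (e / (Q + 1)))%R with (e - e / (Q + 1))%R by (field; lra). lra.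
Qed.

(** * Continued fractions for the ratios of consecutive terms *)

(** The product of the two off-diagonal weights joining the levels [j - 1] and
    [j]; its vanishing at [j = 0] is the boundary condition [c_{-1} = 0]. *)
Definition coupling (gamma : C) (F : nat -> C) (j : nat) : C :=
  RtoC (INR j) * (RtoC (INR j) - RtoC 1 + gamma) * F j.

(** The continued fraction running down from level [j - 1] to level 0; it stands
    for [- F j * c_{j-1} / c_j]. *)
Fixpoint lower (D E G : nat -> C) (x s : C) (j : nat) : C :=
  match j with
  | O => RtoC 0
  | S i => G (S i) / (x - D i - s * E i - s * lower D E G x s i)
  end.

(** The continued fraction running up through the [d] levels [j], ..., [j + d - 1];
    with [c_{j+d} = 0], it stands for
    [- j (j - 1 + gamma) c_j / (s c_{j-1})]. *)
Fixpoint upper (D E G : nat -> C) (x s : C) (j d : nat) : C :=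
  match d with
  | O => RtoC 0
  | S d' => G j / (x - D j - s * E j - s * upper D E G x s (S j) d')
  end.

Lemma c_succ (gamma : C) (D E F : nat -> C) (B s : C) (j : nat) :
  gamma <> - RtoC (INR j) ->
  (RtoC (INR j) + RtoC 1) * (RtoC (INR j) + gamma) * c gamma D E F (S j) B s
  = (B + D j + s * E j) * c gamma D E F j B s
    - s * F j * fst (c_pair gamma D E F B s j).
Proof.
intros Hg. unfold c; simpl. field. split.
- intros H. apply Hg.
  transitivity (RtoC (INR j) + gamma - RtoC (INR j)); [ring|]. rewrite H. ring.
- rewrite <- RtoC_plus, <- S_INR. intros H; apply RtoC_inj in H.
  now apply (not_0_INR (S j)).
Qed.

Lemma tends_denominator (f t : C -> C) (x t0 d e : C) :
  tends f x -> tends t t0 -> tends (fun s => f s - d - s * e - s * t s) (x - d).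
Proof.
intros Hf Ht. replace (x - d) with (x - d - 0 * e - 0 * t0) by ring.
apply tends_minus; [apply tends_minus; [apply tends_minus|]|];
  try apply tends_mult; trivial using tends_const, tends_id.
Qed.

Lemma tends_step (f t : C -> C) (x t0 d e g : C) :
  tends f x -> tends t t0 -> x <> d ->
  tends (fun s => g / (f s - d - s * e - s * t s)) (g / (x - d)).
Proof.
intros Hf Ht Hx. apply tends_div; [apply tends_const| |].
- now apply tends_denominator with t0.
- now apply Cminus_eq_contra.
Qed.

(** Writing [q] for the denominator, [g / q - g / (x - d)] equals
    [- g / (x - d) * (f s - x - s e - s t s) / q], and each term of the bracket
    carries a factor [s]; only the limit of the tail [t] survives. *)
Lemma tends_step_slope (f t : C -> C) (x x1 t0 d e g : C) :
  tends f x -> tends (fun s => (f s - x) / s) x1 -> tends t t0 -> x <> d ->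
  tends (fun s => (g / (f s - d - s * e - s * t s) - g / (x - d)) / s)
    (- (g / (x - d) ^ 2 * (x1 - e - t0))).
Proof.
intros Hf Hf1 Ht Hx. assert (Hxd : x - d <> 0) by now apply Cminus_eq_contra.
assert (Hd := tends_denominator f t x t0 d e Hf Ht).
apply (tends_ext (fun s => (0 - g / (x - d)) * (((f s - x) / s - e - t s)
                     / (f s - d - s * e - s * t s)))).
- generalize (filter_and _ _ near0_neq0 (tends_neq0 _ _ Hd Hxd)).
  apply filter_imp; intros s [Hs Hn]. field. auto.
- replace (- (g / (x - d) ^ 2 * (x1 - e - t0)))
    with ((0 - g / (x - d)) * ((x1 - e - t0) / (x - d))) by (field; auto).
  apply tends_mult; [apply tends_const|]. apply tends_div; trivial.
  apply tends_minus; [apply tends_minus|]; trivial using tends_const.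
Qed.

Lemma tends_lower (D E G : nat -> C) (f : C -> C) (k j : nat) :
  (forall i i' : nat, i <> i' -> D i <> D i') -> G 0%nat = 0 ->
  tends f (D k) -> (j <= k)%nat ->
  tends (fun s => lower D E G (f s) s j) (G j / (D k - D (j - 1)%nat)).
Proof.
intros HD HG Hf. induction j as [|j IH]; intros Hj.
- rewrite HG. unfold Cdiv; rewrite Cmult_0_l. apply tends_const.
- replace (S j - 1)%nat with j by lia.
  apply (tends_step f _ _ _ (D j) (E j) (G (S j)) Hf (IH ltac:(lia))). apply HD; lia.
Qed.

Lemma tends_upper (D E G : nat -> C) (f : C -> C) (k j d : nat) :
  (forall i i' : nat, i <> i' -> D i <> D i') ->
  tends f (D k) -> (k < j)%nat ->
  tends (fun s => upper D E G (f s) s j d)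
    (match d with O => 0 | S _ => G j / (D k - D j) end).
Proof.
intros HD Hf. revert j. induction d as [|d IH]; intros j Hj.
- apply tends_const.
- apply (tends_step f _ _ _ (D j) (E j) (G j) Hf (IH (S j) ltac:(lia))). apply HD; lia.
Qed.

(** The recurrence and the relation at level [j] combine into
    [(j + 1) (j + gamma) c_{j+1} = - q c_j], where [q] is the denominator added at
    this step; as [q] is nonzero near 0, so is [c_{j+1}]. *)
Lemma lower_ratio (gamma : C) (D E F : nat -> C) (f : C -> C) (k j : nat) :
  (forall n : nat, gamma <> - RtoC (INR n)) ->
  (forall i i' : nat, i <> i' -> D i <> D i') ->
  tends f (D k) -> (j <= k)%nat ->
  near0 (fun s => c gamma D E F j (- f s) s <> 0 /\
    - F j * fst (c_pair gamma D E F (- f s) s j)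
    = lower D E (coupling gamma F) (f s) s j * c gamma D E F j (- f s) s).
Proof.
intros Hg HD Hf. set (G := coupling gamma F).
assert (HG : G 0%nat = 0) by (unfold G, coupling; simpl; ring).
induction j as [|j IH]; intros Hj.
- apply filter_forall; intros s. unfold c; simpl. split; [intros H; apply RtoC_inj in H; lra|ring].
- assert (Hxd : D k - D j <> 0) by (apply Cminus_eq_contra, HD; lia).
  assert (Hd := tends_denominator f _ _ _ (D j) (E j) Hf
                  (tends_lower D E G f k j HD HG Hf ltac:(lia))).
  specialize (IH ltac:(lia)).
  generalize (filter_and _ _ IH (tends_neq0 _ _ Hd Hxd)).
  apply filter_imp; intros s [[Hc Hr] Hn].
  assert (Hs := c_succ gamma D E F (- f s) s j (Hg j)).
  change (fst (c_pair gamma D E F (- f s) s (S j))) with (c gamma D E F j (- f s) s).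
  set (w := c gamma D E F (S j) (- f s) s) in *.
  set (v := c gamma D E F j (- f s) s) in *.
  set (q := f s - D j - s * E j - s * lower D E G (f s) s j) in *.
  assert (Hs' : (RtoC (INR j) + 1) * (RtoC (INR j) + gamma) * w = - (q * v)).
  { rewrite Hs. unfold q.
    transitivity ((- f s + D j + s * E j) * v
                  + s * (- F j * fst (c_pair gamma D E F (- f s) s j))); [ring|].
    rewrite Hr. ring. }
  split.
  + intros Hw. rewrite Hw in Hs'. apply (Cmult_neq_0 q v Hn Hc).
    replace (q * v) with (- - (q * v)) by ring. rewrite <- Hs'. ring.
  + change (- F (S j) * v = G (S j) / q * w).
    replace (G (S j) / q * w)
      with ((RtoC (INR j) + 1) * (RtoC (INR j) + gamma) * w * F (S j) / q).
    * rewrite Hs'. field. exact Hn.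
    * unfold G, coupling. rewrite S_INR, RtoC_plus. field. exact Hn.
Qed.

(** Descending induction from [c_{i+1+d} = 0]: the relation at level [i + 1] turns
    the recurrence there into [q c_{i+1} = - s F_{i+1} c_i].  The relation is
    stated as a product because the [c_j] with [j > k] vanish at [s = 0]. *)
Lemma upper_ratio (gamma : C) (D E F : nat -> C) (f : C -> C) (k i d : nat) :
  (forall n : nat, gamma <> - RtoC (INR n)) ->
  (forall i i' : nat, i <> i' -> D i <> D i') ->
  tends f (D k) -> (k <= i)%nat ->
  near0 (fun s => c gamma D E F (S i + d) (- f s) s = 0 ->
    (RtoC (INR i) + 1) * (RtoC (INR i) + gamma) * c gamma D E F (S i) (- f s) s
    = - s * upper D E (coupling gamma F) (f s) s (S i) d * c gamma D E F i (- f s) s).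
Proof.
intros Hg HD Hf. set (G := coupling gamma F). revert i.
induction d as [|d IH]; intros i Hi.
- apply filter_forall; intros s. rewrite Nat.add_0_r. intros H. rewrite H. simpl. ring.
- assert (Hxd : D k - D (S i) <> 0) by (apply Cminus_eq_contra, HD; lia).
  assert (Hd := tends_denominator f _ _ _ (D (S i)) (E (S i)) Hf
                  (tends_upper D E G f k (S (S i)) d HD Hf ltac:(lia))).
  specialize (IH (S i) ltac:(lia)).
  generalize (filter_and _ _ IH (tends_neq0 _ _ Hd Hxd)).
  apply filter_imp; intros s [Hr Hn] H0.
  replace (S i + S d)%nat with (S (S i) + d)%nat in H0 by lia.
  specialize (Hr H0).
  rewrite (c_succ gamma D E F (- f s) s (S i) (Hg (S i))) in Hr.
  change (fst (c_pair gamma D E F (- f s) s (S i))) with (c gamma D E F i (- f s) s) in Hr.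
  set (w := c gamma D E F (S i) (- f s) s) in *.
  set (v := c gamma D E F i (- f s) s) in *.
  change (upper D E G (f s) s (S i) (S d))
    with (G (S i) / (f s - D (S i) - s * E (S i) - s * upper D E G (f s) s (S (S i)) d)).
  set (t := upper D E G (f s) s (S (S i)) d) in *.
  set (q := f s - D (S i) - s * E (S i) - s * t) in *.
  assert (Hw : w = - (s * F (S i) * v) / q).
  { assert (Hq : q * w = - (s * F (S i) * v)).
    { transitivity (- s * t * w - (- f s + D (S i) + s * E (S i)) * w);
        [unfold q; ring|]. rewrite <- Hr. ring. }
    rewrite <- Hq. field. exact Hn. }
  rewrite Hw. unfold G, coupling. rewrite S_INR, RtoC_plus. field. exact Hn.
Qed.

(** * Taylor coefficients of the root *)

Lemma tends_taylor (f : C -> C) (a : nat -> C) :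
  locally (RtoC 0) (fun s : C => is_pseries a s (f s)) ->
  f 0 = a 0%nat /\ tends f (a 0%nat) /\
  tends (fun s => (f s - a 0%nat) / s) (a 1%nat) /\
  tends (fun s => ((f s - a 0%nat) / s - a 1%nat) / s) (a 2%nat).
Proof.
intros Hf.
assert (H0 := near0_of_locally _ Hf).
assert (H1 := near0_pseries_quotient _ _ H0).
assert (H2 := near0_pseries_quotient _ _ H1).
split; [|repeat split].
- exact (@filterlim_locally_unique nat C_AbsRing C_NormedModule eventually _ _ _ _
    (locally_singleton _ _ Hf) (is_pseries_0 a)).
- exact (tends_pseries _ _ H0).
- exact (tends_pseries _ _ H1).
- exact (tends_pseries _ _ H2).
Qed.

(** The ratio relations from below and from above, substituted in the recurrence
    at level [k], leave a multiple of [c_k], which is nonzero near 0. *)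
Lemma root_equation (gamma : C) (D E F : nat -> C) (k m : nat) (f : C -> C) :
  (forall n : nat, gamma <> - RtoC (INR n)) ->
  (forall i j : nat, i <> j -> D i <> D j) ->
  tends f (D k) -> (k <= m)%nat ->
  near0 (fun s => c gamma D E F (S m) (- f s) s = 0) ->
  near0 (fun s => (f s - D k) / s
    = E k + lower D E (coupling gamma F) (f s) s k
      + upper D E (coupling gamma F) (f s) s (S k) (m - k)).
Proof.
intros Hg HD Hf Hk Hroot.
assert (Hlow := lower_ratio gamma D E F f k k Hg HD Hf (le_n k)).
assert (Hup := upper_ratio gamma D E F f k k (m - k) Hg HD Hf (le_n k)).
generalize (filter_and _ _ (filter_and _ _ Hroot near0_neq0) (filter_and _ _ Hlow Hup)).
apply filter_imp; intros s [[H0 Hs] [[Hc Hl] Hu]].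
replace (S k + (m - k))%nat with (S m) in Hu by lia. specialize (Hu H0).
rewrite (c_succ gamma D E F (- f s) s k (Hg k)) in Hu.
set (v := c gamma D E F k (- f s) s) in *.
set (l := lower D E (coupling gamma F) (f s) s k) in *.
set (u := upper D E (coupling gamma F) (f s) s (S k) (m - k)) in *.
assert (H : (f s - D k) * v = s * (E k + l + u) * v).
{ transitivity (s * E k * v + s * (- F k * fst (c_pair gamma D E F (- f s) s k))
     - ((- f s + D k + s * E k) * v - s * F k * fst (c_pair gamma D E F (- f s) s k)));
    [ring|]. rewrite Hl, Hu. ring. }
assert (H' : f s - D k = s * (E k + l + u)).
{ replace (f s - D k) with ((f s - D k) * v / v) by (field; auto).
  rewrite H. field; auto. }
rewrite H'. field; auto.
Qed.

(** Both sides of [root_equation] are expanded to first order in [s].  The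
    truncated indices [k - 1] and [k - 2] are harmless for [k = 0, 1], where they
    occur under a factor [G 0 = 0].  The bound [k + 2 <= m] makes the upper
    fraction at least two levels deep, so that its tail has the limit
    [G (k + 2) / (D k - D (k + 2))]. *)
Lemma second_coefficient (gamma : C) (D E F : nat -> C) (k m : nat)
    (f : C -> C) (a : nat -> C) (G := coupling gamma F) :
  (forall n : nat, gamma <> - RtoC (INR n)) ->
  (forall i j : nat, i <> j -> D i <> D j) ->
  (k + 2 <= m)%nat -> root_germ gamma D E F k m f a ->
  let l := G k / (D k - D (k - 1)%nat) in
  let u := G (k + 1)%nat / (D k - D (k + 1)%nat) in
  a 1%nat = E k + l + u /\
  a 2%nat =
    - (G k / (D k - D (k - 1)%nat) ^ 2
       * (a 1%nat - E (k - 1)%nat - G (k - 1)%nat / (D k - D (k - 2)%nat)))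
    - G (k + 1)%nat / (D k - D (k + 1)%nat) ^ 2
       * (a 1%nat - E (k + 1)%nat - G (k + 2)%nat / (D k - D (k + 2)%nat)).
Proof.
intros Hg HD Hm [Hf0 [Hser Hroot]] l. rewrite Nat.add_1_r. intros u.
destruct (tends_taylor f a Hser) as [Ha0 [Hf [Hf1 Hf2]]].
rewrite Hf0 in Ha0. rewrite <- Ha0 in Hf, Hf1, Hf2.
assert (HG : G 0%nat = 0) by (unfold G, coupling; simpl; ring).
assert (Heq := root_equation gamma D E F k m f Hg HD Hf ltac:(lia)
                 (near0_of_locally _ Hroot)).
fold G in Heq.
destruct (m - k)%nat as [|[|d]] eqn:Hd; [lia|lia|].
assert (Hl : tends (fun s => lower D E G (f s) s k) l)
  by (apply tends_lower; auto).
assert (Hu : tends (fun s => upper D E G (f s) s (S k) (S (S d))) u)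
  by (exact (tends_upper D E G f k (S k) (S (S d)) HD Hf ltac:(lia))).
assert (H1 : a 1%nat = E k + l + u).
{ apply (tends_unique _ _ _ Hf1).
  apply (tends_ext (fun s => E k + lower D E G (f s) s k
                             + upper D E G (f s) s (S k) (S (S d)))).
  - revert Heq. apply filter_imp. auto.
  - apply tends_plus; [apply tends_plus|]; trivial using tends_const. }
split; [exact H1|].
apply (tends_unique _ _ _ Hf2).
apply (tends_ext (fun s => (lower D E G (f s) s k - l) / s
                   + (upper D E G (f s) s (S k) (S (S d)) - u) / s)).
{ generalize (filter_and _ _ Heq near0_neq0). apply filter_imp. intros s [Hs Hs0].
  rewrite Hs, H1. field. exact Hs0. }
apply tends_plus.
- unfold l. destruct k as [|j].
  (* There is no level below 0, and the slope is 0 on both sides. *)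
  + rewrite HG. apply (tends_ext (fun _ => RtoC 0)).
    * apply filter_forall. intros s. simpl. unfold Cdiv. ring.
    * match goal with |- tends _ ?r => replace r with (RtoC 0) by (unfold Cdiv; ring) end.
      apply tends_const.
  + replace (S j - 1)%nat with j by lia. replace (S j - 2)%nat with (j - 1)%nat by lia.
    apply (tends_step_slope f (fun s => lower D E G (f s) s j)); trivial.
    * apply tends_lower; auto; lia.
    * apply HD; lia.
- replace (k + 2)%nat with (S (S k)) by lia.
  apply (tends_step_slope f (fun s => upper D E G (f s) s (S (S k)) (S d))); trivial.
  + exact (tends_upper D E G f k (S (S k)) (S d) HD Hf ltac:(lia)).
  + apply HD; lia.
Qed.

Theorem theorem4p9
  (gamma : C) (D E F : nat -> C)
  (hgamma : forall n : nat, gamma <> - RtoC (INR n))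
  (hD : forall i j : nat, i <> j -> D i <> D j) :
  (forall (k m : nat) (f : C -> C) (a : nat -> C),
     (2 <= k)%nat -> (k + 2 <= m)%nat ->
     root_germ gamma D E F k m f a ->
     let K : C := RtoC (INR k) in
     a 2%nat =
       - (K * (K - RtoC 1 + gamma) * F k / (D k - D (k - 1)%nat) ^ 2
          + (K + RtoC 1) * (K + gamma) * F (k + 1)%nat / (D k - D (k + 1)%nat) ^ 2)
         * (E k
            + K * (K - RtoC 1 + gamma) * F k / (D k - D (k - 1)%nat)
            + (K + RtoC 1) * (K + gamma) * F (k + 1)%nat / (D k - D (k + 1)%nat))
       + K * (K - RtoC 1 + gamma) * F k / (D k - D (k - 1)%nat) ^ 2
         * (E (k - 1)%nat
            + (K - RtoC 1) * (K - RtoC 2 + gamma) * F (k - 1)%nat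
              / (D k - D (k - 2)%nat))
       + (K + RtoC 1) * (K + gamma) * F (k + 1)%nat / (D k - D (k + 1)%nat) ^ 2
         * (E (k + 1)%nat
            + (K + RtoC 2) * (K + RtoC 1 + gamma) * F (k + 2)%nat
              / (D k - D (k + 2)%nat)))
  /\
  (forall (m : nat) (f : C -> C) (a : nat -> C),
     (3 <= m)%nat ->
     root_germ gamma D E F 1 m f a ->
     a 2%nat =
       - (gamma * F 1%nat / (D 1%nat - D 0%nat) ^ 2
          + RtoC 2 * (RtoC 1 + gamma) * F 2%nat / (D 1%nat - D 2%nat) ^ 2)
         * (E 1%nat
            + gamma * F 1%nat / (D 1%nat - D 0%nat)
            + RtoC 2 * (RtoC 1 + gamma) * F 2%nat / (D 1%nat - D 2%nat))
       + gamma * E 0%nat * F 1%nat / (D 1%nat - D 0%nat) ^ 2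
       + RtoC 2 * (RtoC 1 + gamma) * F 2%nat / (D 1%nat - D 2%nat) ^ 2
         * (E 2%nat
            + RtoC 3 * (RtoC 2 + gamma) * F 3%nat / (D 1%nat - D 3%nat)))
  /\
  (forall (m : nat) (f : C -> C) (a : nat -> C),
     (2 <= m)%nat ->
     root_germ gamma D E F 0 m f a ->
     a 2%nat =
       gamma * F 1%nat / (D 0%nat - D 1%nat) ^ 2
         * (E 1%nat - E 0%nat
            - gamma * F 1%nat / (D 0%nat - D 1%nat)
            + RtoC 2 * (RtoC 1 + gamma) * F 2%nat / (D 0%nat - D 2%nat))).
Proof.
assert (two : RtoC 2 = RtoC 1 + RtoC 1) by (rewrite <- RtoC_plus; apply f_equal; ring).
assert (three : RtoC 3 = RtoC 1 + RtoC 2) by (rewrite <- RtoC_plus; apply f_equal; ring).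
(* The general formula is valid for k = 0 and k = 1 too: the factors K and K - 1
   then remove the terms in which a truncated subtraction occurs. *)
assert (main : forall (k m : nat) (f : C -> C) (a : nat -> C),
     (k + 2 <= m)%nat -> root_germ gamma D E F k m f a ->
     let K : C := RtoC (INR k) in
     a 2%nat =
       - (K * (K - RtoC 1 + gamma) * F k / (D k - D (k - 1)%nat) ^ 2
          + (K + RtoC 1) * (K + gamma) * F (k + 1)%nat / (D k - D (k + 1)%nat) ^ 2)
         * (E k
            + K * (K - RtoC 1 + gamma) * F k / (D k - D (k - 1)%nat)
            + (K + RtoC 1) * (K + gamma) * F (k + 1)%nat / (D k - D (k + 1)%nat))
       + K * (K - RtoC 1 + gamma) * F k / (D k - D (k - 1)%nat) ^ 2
         * (E (k - 1)%nat
            + (K - RtoC 1) * (K - RtoC 2 + gamma) * F (k - 1)%nat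
              / (D k - D (k - 2)%nat))
       + (K + RtoC 1) * (K + gamma) * F (k + 1)%nat / (D k - D (k + 1)%nat) ^ 2
         * (E (k + 1)%nat
            + (K + RtoC 2) * (K + RtoC 1 + gamma) * F (k + 2)%nat
              / (D k - D (k + 2)%nat))).
{ intros k m f a Hm Hf K.
  destruct (second_coefficient gamma D E F k m f a hgamma hD Hm Hf) as [H1 H2].
  rewrite H2, H1.
  assert (G1 : coupling gamma F (k + 1)%nat = (K + RtoC 1) * (K + gamma) * F (k + 1)%nat).
  { unfold coupling, K. rewrite plus_INR, RtoC_plus; simpl. ring. }
  assert (G2 : coupling gamma F (k + 2)%nat
               = (K + RtoC 2) * (K + RtoC 1 + gamma) * F (k + 2)%nat).
  { unfold coupling, K. rewrite plus_INR; simpl. rewrite !RtoC_plus, two. ring. }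
  (* For k = 0 the index k - 1 truncates to 0, but is weighted by K = 0. *)
  rewrite G1, G2. destruct k as [|j].
  - unfold coupling, K; simpl INR. unfold Cdiv. ring.
  - assert (G3 : coupling gamma F (S j - 1)%nat
                 = (K - RtoC 1) * (K - RtoC 2 + gamma) * F (S j - 1)%nat).
    { unfold coupling, K. rewrite minus_INR, RtoC_minus by lia. simpl (INR 1).
      rewrite two. ring. }
    rewrite G3. unfold coupling; fold K. unfold Cdiv. ring. }
split; [|split].
- intros k m f a _. apply main.
- intros m f a Hm Hf. rewrite (main 1%nat m f a Hm Hf); simpl. unfold Cdiv.
  rewrite three, two. ring.
- intros m f a Hm Hf. rewrite (main 0%nat m f a Hm Hf); simpl. unfold Cdiv. ring.
Qed.
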